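(* Let $K\subset\mathbb R^d$ be an arbitrary compact container, let $w>0$, and let $r_1>\dots>r_n>0$ be superincreasing, or more generally weakly superincreasing: $r_i\ge\sum_{j>i}r_j$ for all $i$. Then every descending greedy, with an arbitrary rule for choosing among feasible (admitting) containers, places exactly the lex-max feasible set. In particular best fit, worst fit and random placement are all optimal: the set they place maximizes $\sum_{i\in S}v(r_i)$ over feasible sets $S$, for every positive, strictly increasing, superadditive function $v$ on $(0,\infty)$.
   Context: Model. Fix a width $w>0$ and a compact container $K\subset\mathbb R^d$, $d\ge1$ (the pan). An inventory is a finite list of radii $r_1>r_2>\dots>r_n>0$; ring $i$ has outer radius $r_i$ and hole radius $\max(0,r_i-w)$. A placement of a set $S\subseteq\{1,\dots,n\}$ of rings is a forest: each ring of $S$ has as parent either the pan or another ring of $S$ with $r_{\mathrm{child}}\le r_{\mathrm{parent}}-w$, and the children of each common parent must be packable in the parent's region ($K$ for the pan; a ball of radius $r-w$ for the hole of a ring of radius $r$), i.e. closed balls having the children's outer radii can be positioned inside that region with pairwise disjoint interiors. Feasibility depends only on the parent assignment (siblings may be rearranged freely). $S$ is feasible if it has a placement. The lex-max set $L$ is defined by scanning $i=1,\dots,n$ and including $i$ whenever $(L\cap\{1,\dots,i-1\})\cup\{i\}$ is feasible; it is the unique lexicographically maximal feasible set. A descending greedy processes the rings in decreasing radius; when ring $i$ is processed, a container (the pan or the hole of an already placed ring) admits it if the container's current children together with ring $i$ are packable in it; the ring receives some admitting container as its permanent parent, chosen by the placement rule, and is skipped only if no container admits it. The capacity of a hole is its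 radius, and the capacity of the pan is the radius of its largest inscribed ball. Best fit chooses the admitting container of smallest capacity, worst fit the one of largest capacity, random placement a random admitting container. $v$ is superadditive if $v(x)+v(y)\le v(x+y)$ for all $x,y>0$. *)

(* Defs.v *)
From mathcomp Require Import all_boot all_order all_algebra.
From mathcomp Require Import all_classical all_reals all_analysis.

Set Implicit Arguments.
Unset Strict Implicit.
Unset Printing Implicit Defensive.

Import Order.TTheory GRing.Theory Num.Theory.
Import numFieldNormedType.Exports.

Local Open Scope classical_set_scope.
Local Open Scope ring_scope.

(* The library norm on 'rV[R]_d is the sup norm; it induces the Euclidean
   topology, but the balls to be packed are Euclidean. *)
Definition edist (R : realType) (d : nat) (x y : 'rV[R]_d) : R :=
  Num.sqrt (\sum_(k < d) (x ord0 k - y ord0 k) ^+ 2).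

Definition closed_eball (R : realType) (d : nat) (x : 'rV[R]_d) (rho : R) :
  set 'rV[R]_d := [set y | edist x y <= rho].

(* A container is the pan (None) or the hole of ring j (Some j). *)
Notation container n := (option 'I_n).

(* A parent assignment: None for a ring that is not placed, Some c for a ring
   whose parent is the container c. *)
Notation assignment n := {ffun 'I_n -> option (option 'I_n)}.

Definition placed n (st : assignment n) : {set 'I_n} :=
  [set i | st i != None]%SET.

Definition children n (st : assignment n) (c : container n) : {set 'I_n} :=
  [set i | st i == Some c]%SET.

Definition assign n (st : assignment n) (i : 'I_n) (c : container n) :
  assignment n := [ffun k => if k == i then Some c else st k].

Definition unplaced n : assignment n := [ffun=> None].

(* Ring i (0-based) has outer radius r i. *)
Section Packing.
Variables (R : realType) (d n : nat).
Variables (K : set 'rV[R]_d) (w : R) (r : 'I_n -> R).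

Definition hole_radius (j : 'I_n) : R := Num.max 0 (r j - w).

Definition region (c : container n) : set 'rV[R]_d :=
  if c is Some j then closed_eball 0 (hole_radius j) else K.

Definition packable (A : {set 'I_n}) (X : set 'rV[R]_d) : Prop :=
  exists x : 'I_n -> 'rV[R]_d,
    (forall i, i \in A -> closed_eball (x i) (r i) `<=` X) /\
    (forall i j, i \in A -> j \in A -> i != j ->
      interior (closed_eball (x i) (r i)) `&`
      interior (closed_eball (x j) (r j)) = set0).

(* For w > 0 the radius condition makes the parent relation acyclic, i.e. a
   forest rooted at the pan. *)
Definition is_placement (st : assignment n) : Prop :=
  (forall i j, st i = Some (Some j) -> j \in placed st /\ r i <= r j - w) /\
  (forall c, packable (children st c) (region c)).

Definition feasible (S : {set 'I_n}) : Prop :=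
  exists st, placed st = S /\ is_placement st.

(* enum 'I_n is increasing in the index, so the accumulator at step i is
   the part of the lex-max set below i. *)
Definition lexmax : {set 'I_n} :=
  foldl (fun (L : {set 'I_n}) i => if `[< feasible (i |: L)%SET >]
                                   then (i |: L)%SET else L)
        (finset.set0 : {set 'I_n}) (enum 'I_n).

Definition available (st : assignment n) (c : container n) : Prop :=
  if c is Some j then j \in placed st else True.

Definition admits (st : assignment n) (i : 'I_n) (c : container n) : Prop :=
  available st c /\ packable (i |: children st c)%SET (region c).

(* The capacity of the pan is the radius of its largest inscribed ball. *)
Definition capacity (c : container n) : R :=
  if c is Some j then hole_radius j
  else sup [set rho : R | 0 <= rho /\ exists x, closed_eball x rho `<=` K].

(* The current assignment together with the ring being processed determines
   the whole history of the run, so a rule may be history-dependent. *)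
Definition placement_rule := assignment n -> 'I_n -> container n.

Definition valid_rule (rule : placement_rule) : Prop :=
  forall st i, (exists c, admits st i c) -> admits st i (rule st i).

Definition greedy_step (rule : placement_rule) (st : assignment n) (i : 'I_n) :
  assignment n :=
  if `[< exists c, admits st i c >] then assign st i (rule st i) else st.

Definition greedy (rule : placement_rule) : assignment n :=
  foldl (greedy_step rule) (unplaced n) (enum 'I_n).

Definition best_fit (rule : placement_rule) : Prop :=
  valid_rule rule /\
  forall st i c, admits st i c -> capacity (rule st i) <= capacity c.

Definition worst_fit (rule : placement_rule) : Prop :=
  valid_rule rule /\
  forall st i c, admits st i c -> capacity c <= capacity (rule st i).

(* mu st i is the law of the container drawn for ring i in state st, an
   arbitrary probability on the admitting containers. *)
Definition random_rule := assignment n -> 'I_n -> container n -> R.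

Definition valid_random_rule (mu : random_rule) : Prop :=
  forall st i, (exists c, admits st i c) ->
    [/\ forall c, 0 <= mu st i c,
        forall c, ~ admits st i c -> mu st i c = 0
      & \sum_c mu st i c = 1].

Definition transition (mu : random_rule) (i : 'I_n) (st st' : assignment n) :
  R :=
  if `[< exists c, admits st i c >]
  then \sum_c mu st i c * (st' == assign st i c)%:R
  else (st' == st)%:R.

(* Law of the final state of the random greedy, as a mass function. *)
Definition random_greedy (mu : random_rule) : assignment n -> R :=
  foldl (fun (D : assignment n -> R) i => fun st' =>
           \sum_(st : assignment n) D st * transition mu i st st')
        (fun st => (st == unplaced n)%:R) (enum 'I_n).

Definition random_greedy_prob (mu : random_rule) (E : {set 'I_n} -> Prop) : R :=
  \sum_(st : assignment n | `[< E (placed st) >]) random_greedy mu st.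

Definition optimal (v : R -> R) (S : {set 'I_n}) : Prop :=
  feasible S /\
  forall S' : {set 'I_n}, feasible S' ->
    \sum_(i in S') v (r i) <= \sum_(i in S) v (r i).

End Packing.

Definition superadditive (R : realType) (v : R -> R) : Prop :=
  forall x y, 0 < x -> 0 < y -> v x + v y <= v (x + y).

(* Main.v *)
Require Import Defs.
From mathcomp Require Import all_boot all_order all_algebra.
From mathcomp Require Import all_classical all_reals all_analysis.
From mathcomp Require Import lra.

Set Implicit Arguments.
Unset Strict Implicit.
Unset Printing Implicit Defensive.

Import Order.TTheory GRing.Theory Num.Theory.
Import numFieldNormedType.Exports.

Local Open Scope classical_set_scope.
Local Open Scope ring_scope.

(** The proof is an exchange argument on parent assignments.  Weak
superincrease gives one geometric fact: the balls of all rings smaller than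
ring k, laid side by side along a diameter, fit together inside a single ball
of radius r_k ([packable_exchange]).

Let st be a placement of a set P of rings, all larger than ring i, and let F
be any placement of P together with i.  If st and F first differ at ring k,
say F puts k into c and st puts it into c', then F can be corrected: move k to
c', and move all smaller rings that F has in c' into the ball that k vacates
in c.  The container c' now holds only rings that st also has there, so it
stays packable, and every smaller ring meets the parent condition of c because
k did.  So F can be made to agree with st on all rings larger than i
([exchange_first_difference], [agree_below]); then the parent of i in F admits
i in st.  Therefore a ring is admitted by some container exactly when its
addition to the set already placed is feasible, whatever parents have been
chosen earlier ([admits_feasible]).  That test is the one that defines the
lex-max set, so every rule, and every run of positive probability of a random
rule, places the lex-max set.

The lex-max set is optimal in one step: at the first ring k where it differs
from another feasible set, the lex-max set contains k, and superadditivity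
bounds the total value of all smaller rings by v(r_k) ([lexmax_optimal]). *)

(** * Euclidean balls and translation along an axis *)

Section EuclideanBalls.
Variables (R : realType) (d : nat).
Implicit Types (x y : 'rV[R]_d) (k : 'I_d) (a b rho : R).

Lemma closed_eballP x rho y : 0 <= rho ->
  closed_eball x rho y <-> \sum_(l < d) (x ord0 l - y ord0 l) ^+ 2 <= rho ^+ 2.
Proof.
move=> rho0; rewrite /closed_eball /edist /=.
by rewrite -[rho in X in X <-> _](ger0_norm rho0) -sqrtr_sqr ler_sqrt ?sqr_ge0.
Qed.

Lemma closed_eball_coord x rho y k : 0 <= rho -> closed_eball x rho y ->
  `|x ord0 k - y ord0 k| <= rho.
Proof.
move=> rho0 /(closed_eballP _ _ rho0); rewrite (bigD1 k)//= => xy.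
rewrite -(ler_pXn2r (n := 2))// ?nnegrE ?normr_ge0//.
rewrite real_normK ?num_real//; apply: le_trans xy.
by rewrite lerDl; apply: sumr_ge0 => l _; exact: sqr_ge0.
Qed.

Definition shift_coord k x a : 'rV[R]_d :=
  \row_l (x ord0 l + (if l == k then a else 0)).

Lemma shift_coordE k x a : shift_coord k x a ord0 k = x ord0 k + a.
Proof. by rewrite mxE eqxx. Qed.

Lemma sum_sqr_shift_coord k x y a :
  \sum_(l < d) (shift_coord k x a ord0 l - y ord0 l) ^+ 2 =
  \sum_(l < d) (x ord0 l - y ord0 l) ^+ 2 +
    2 * a * (x ord0 k - y ord0 k) + a ^+ 2.
Proof.
rewrite (bigD1 k)//= [in RHS](bigD1 k)//= shift_coordE.
rewrite (eq_bigr (fun l => (x ord0 l - y ord0 l) ^+ 2)); last first.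
  by move=> l /negbTE lk; rewrite mxE lk addr0.
by set s := \sum_(_ < _ | _) _; set u := x _ _; set v := y _ _; lra.
Qed.

Lemma shift_coord_in_closed_eball k x a rho : 0 <= rho -> `|a| <= rho ->
  closed_eball x rho (shift_coord k x a).
Proof.
move=> rho0 arho; apply/closed_eballP => //.
under eq_bigr do rewrite -sqrrN opprB.
rewrite sum_sqr_shift_coord subrr mulr0 addr0.
rewrite big1 ?add0r; last by move=> l _; rewrite subrr expr0n.
by rewrite -[a ^+ 2]real_normK ?num_real// ler_pXn2r// ?nnegrE.
Qed.

(** The two points of the small ball at signed distance a from its centre along
an axis differ by 2a in that coordinate, while two points of the large ball
differ by at most 2b. *)
Lemma closed_eball_radius_le k x y a b : 0 <= a -> 0 <= b ->
  closed_eball x a `<=` closed_eball y b -> a <= b.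
Proof.
move=> a0 b0 sub.
have Hp := sub _ (@shift_coord_in_closed_eball k x a a a0 _).
have Hm := sub _ (@shift_coord_in_closed_eball k x (- a) a a0 _).
have := closed_eball_coord k b0 (Hp _).
have := closed_eball_coord k b0 (Hm _).
rewrite normrN ger0_norm// lexx !shift_coordE.
move=> /(_ isT); rewrite ler_norml => /andP[h1 h2].
move=> /(_ isT); rewrite ler_norml => /andP[h3 h4]; lra.
Qed.

(** The triangle inequality for centres that differ along an axis only: the
squared distance then expands in one coordinate, so Cauchy-Schwarz is
avoided. *)
Lemma closed_eball_shift_coord_sub k x a b rho : 0 <= b -> `|a| + b <= rho ->
  closed_eball (shift_coord k x a) b `<=` closed_eball x rho.
Proof.
move=> b0 abr y yb; have rho0 : 0 <= rho.
  by apply: le_trans abr; rewrite addr_ge0.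
apply/closed_eballP => //.
have := closed_eball_coord k b0 yb; rewrite shift_coordE addrAC ler_norml.
move: yb => /closed_eballP-/(_ b0); rewrite sum_sqr_shift_coord.
move: (\sum_(_ < _) _) (x _ _ - _) => s t st /andP[t1 t2].
have : (`|a| + b) ^+ 2 <= rho ^+ 2 by rewrite ler_pXn2r// ?nnegrE ?addr_ge0.
apply: le_trans.
case: (ger0P a) => a0.
  have : 0 <= a * (b + (t + a)) by apply: mulr_ge0; lra.
  by lra.
have : 0 <= - a * (b - (t + a)) by apply: mulr_ge0; lra.
by lra.
Qed.

Lemma interior_shift_coord k (A : set 'rV[R]_d) y : A° y ->
  exists2 e, 0 < e & A (shift_coord k y e).
Proof.
rewrite /interior/= => /nbhs_ballP[e /= e0 eA]; exists (e / 2); first lra.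
apply: eA; split=> // i j; rewrite ord1 /= mxE /ball/=.
by case: eqP => _; rewrite ?addr0 ?subrr ?normr0// opprD addNKr normrN gtr0_norm; lra.
Qed.

(** Each ball lies in a slab orthogonal to the axis, and the two slabs share at
most a hyperplane.  A common interior point could be pushed a little further
along the axis without leaving the first ball, which overshoots its slab. *)
Lemma interior_closed_eball_disjoint k x y a b : 0 <= a -> 0 <= b ->
  x ord0 k + a <= y ord0 k - b ->
  (closed_eball x a)° `&` (closed_eball y b)° = set0.
Proof.
move=> a0 b0 xy; rewrite -subset0 => z [xz yz] /=.
have [e e0 /(closed_eball_coord k a0)] := @interior_shift_coord k _ _ xz.
have /(closed_eball_coord k b0) := interior_subset yz.
by rewrite shift_coordE !ler_norml => /andP[h1 h2] /andP[h3 h4]; lra.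
Qed.

End EuclideanBalls.

(** * Packings *)

Section Packings.
Variables (R : realType) (d n : nat) (r : 'I_n -> R).
Hypotheses (d_ge1 : (1 <= d)%N) (r_gt0 : forall i, 0 < r i).
Implicit Types (A B T : {set 'I_n}) (X : set 'rV[R]_d).

Let axis : 'I_d := Ordinal d_ge1.

Lemma packable_sub A B X : A \subset B -> packable r B X -> packable r A X.
Proof.
move=> /fintype.subsetP AB [x [xX xdisj]]; exists x; split.
  by move=> i /AB; exact: xX.
by move=> i j /AB iB /AB jB; exact: xdisj.
Qed.

Lemma packable_set0 X : packable r finset.set0 X.
Proof. by exists (fun=> 0); split=> i; rewrite finset.in_set0. Qed.

Lemma packable_closed_eball_radius A rho i : 0 <= rho ->
  packable r A (closed_eball (0 : 'rV[R]_d) rho) -> i \in A -> r i <= rho.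
Proof.
move=> rho0 [x [xX _]] /xX; apply: (closed_eball_radius_le axis) => //.
exact/ltW/r_gt0.
Qed.

(** Signed distance, along an axis, from the centre of ball k to the centre of
ball t, when the balls of the rings k+1, k+2, ... are lined up tangent to each
other, the first one touching ball k from inside. *)
Definition row_offset (k t : 'I_n) : R :=
  2 * (\sum_(s < n | (k < s < t)%N) r s) + r t - r k.

Lemma row_offset_step (k s t : 'I_n) : (k < s)%N -> (s < t)%N ->
  row_offset k s + r s <= row_offset k t - r t.
Proof.
move=> ks st; rewrite /row_offset.
suff : \sum_(u < n | (k < u < s)%N) r u + r s <=
       \sum_(u < n | (k < u < t)%N) r u by lra.
rewrite [leRHS](bigD1 s)/=; last by rewrite ks.
rewrite [leLHS]addrC lerD2l big_mkcond [leRHS]big_mkcond/=.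
apply: ler_sum => u _; have := ltW (r_gt0 u).
case: ifP => [/andP[ku us] _|_]; last by case: ifP.
by rewrite ku (ltn_trans us st)/= -val_eqE/= ltn_eqF.
Qed.

Lemma row_offset_bound (k t : 'I_n) : \sum_(s < n | (k < s)%N) r s <= r k ->
  (k < t)%N -> `|row_offset k t| + r t <= r k.
Proof.
move=> rk kt; rewrite -lerBrDr ler_norml /row_offset.
have s0 : 0 <= \sum_(s < n | (k < s < t)%N) r s.
  by apply: sumr_ge0 => s _; exact/ltW/r_gt0.
have : \sum_(s < n | (k < s < t)%N) r s + r t <= r k.
  apply: le_trans rk; rewrite [leRHS](bigD1 t)//= [leLHS]addrC lerD2l.
  rewrite big_mkcond [leRHS]big_mkcond/=.
  apply: ler_sum => u _; have := ltW (r_gt0 u).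
  case: ifP => [/andP[ku ut] _|_]; last by case: ifP.
  by rewrite ku/= -val_eqE/= ltn_eqF.
by move=> ?; apply/andP; split; lra.
Qed.

(** The ball of a ring k can be replaced by the balls of any rings after k: they
stay inside it, hence inside X and away from the interiors of the other
balls. *)
Lemma packable_exchange A T X (k : 'I_n) :
  \sum_(s < n | (k < s)%N) r s <= r k -> k \in A ->
  (forall t, t \in T -> (k < t)%N) ->
  packable r A X -> packable r (A :\ k :|: T)%SET X.
Proof.
move=> rk kA Tk [x [xX xdisj]].
have r0 i : 0 <= r i by exact/ltW/r_gt0.
pose y i := if i \in T then shift_coord axis (x k) (row_offset k i) else x i.
have yk t : t \in T ->
    closed_eball (y t) (r t) `<=` closed_eball (x k) (r k).
  move=> tT; rewrite /y tT; apply: closed_eball_shift_coord_sub => //.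
  exact/row_offset_bound/Tk.
have old i : i \in (A :\ k :|: T)%SET -> i \notin T ->
    [/\ i \in A, i != k & y i = x i].
  by rewrite !inE /y => /orP[/andP[-> ->]|->//] /negbTE->.
exists y; split=> [i iAT|].
  have [iT|iT] := boolP (i \in T).
    by apply: subset_trans (yk i iT) _; exact: xX.
  by have [iA _ ->] := old i iAT iT; exact: xX.
(* Disjointness is symmetric in i and j, so among the exchanged rings only
   i < j matters, and a mixed pair may be taken with j the old ring. *)
suff H i j : i \in (A :\ k :|: T)%SET -> j \in (A :\ k :|: T)%SET ->
    i != j -> (j \in T -> (i \in T) && (i < j)%N) ->
    (closed_eball (y i) (r i))° `&` (closed_eball (y j) (r j))° = set0.
  move=> i j iAT jAT ij.
  have [iT|iT] := boolP (i \in T); have [jT|jT] := boolP (j \in T).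
  - have := ij; rewrite -val_eqE/= neq_ltn => /orP[lt_ij|lt_ji].
      by apply: H => // _; rewrite iT.
    by rewrite setIC; apply: H => //; [rewrite eq_sym|rewrite jT].
  - by apply: H => //; rewrite (negbTE jT).
  - by rewrite setIC; apply: H => //; [rewrite eq_sym|rewrite (negbTE iT)].
  - by apply: H => //; rewrite (negbTE jT).
move=> iAT jAT ij ijT; have [jT|jT] := boolP (j \in T).
  have /andP[iT lt_ij] := ijT jT; apply: (interior_closed_eball_disjoint (k := axis)) => //.
  rewrite /y iT jT !shift_coordE.
  by have := row_offset_step (Tk i iT) lt_ij; lra.
have [jA jk yj] := old j jAT jT; rewrite yj.
have [iT|iT] := boolP (i \in T); last first.
  by have [iA _ ->] := old i iAT iT; exact: xdisj.
rewrite -subset0 -(xdisj k j kA jA _); last by rewrite eq_sym.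
by apply: setSI; apply: interiorS; exact: yk.
Qed.

End Packings.

(** * Placements *)

Section Placements.
Variables (R : realType) (d n : nat) (K : set 'rV[R]_d) (w : R) (r : 'I_n -> R).
Hypotheses (d_ge1 : (1 <= d)%N) (w_gt0 : 0 < w) (r_gt0 : forall i, 0 < r i).
Hypothesis r_decr : forall i j : 'I_n, (i < j)%N -> r j < r i.
Implicit Types (st F : assignment n) (c : container n) (i j k : 'I_n).
Implicit Types (S : {set 'I_n}).

Lemma in_placed st i : (i \in placed st) = (st i != None).
Proof. by rewrite inE. Qed.

Lemma in_children st c i : (i \in children st c) = (st i == Some c).
Proof. by rewrite inE. Qed.

Lemma placed_assign st i c : placed (assign st i c) = (i |: placed st)%SET.
Proof. by apply/finset.setP => k; rewrite !inE ffunE; case: (eqVneq k i). Qed.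

Lemma placed_unplaced : placed (unplaced n) = finset.set0.
Proof. by apply/finset.setP => k; rewrite !inE ffunE. Qed.

Lemma is_placement_unplaced : is_placement K w r (unplaced n).
Proof.
split=> [i j|c]; first by rewrite ffunE.
apply: packable_sub (packable_set0 _ _).
by apply/fintype.subsetP => i; rewrite in_children ffunE.
Qed.

Lemma hole_radius_ge0 j : 0 <= hole_radius w r j.
Proof. by rewrite /hole_radius le_max lexx. Qed.

Lemma hole_radius_lt i j : 0 < r i -> r i <= hole_radius w r j -> r i <= r j - w.
Proof. by rewrite /hole_radius le_max => ri /orP[|//]; rewrite leNgt ri. Qed.

(** Admission asks only for a packing, yet it yields the parent condition of a
placement: a ball contained in a hole has at most the radius of the hole. *)
Lemma is_placement_assign st i c :
  is_placement K w r st -> i \notin placed st -> admits K w r st i c ->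
  is_placement K w r (assign st i c).
Proof.
move=> [st_par st_pack] ist [c_av c_pack]; split=> [j p|e].
  rewrite placed_assign !inE ffunE; case: (eqVneq j i) => [->{j} [cp]|_].
    subst c; split; first by move: c_av; rewrite /= inE => ->; rewrite orbT.
    apply: hole_radius_lt => //.
    apply: (packable_closed_eball_radius d_ge1 r_gt0 _ c_pack).
      exact: hole_radius_ge0.
    exact: finset.setU11.
  by move=> /st_par; rewrite inE => -[-> ?]; rewrite orbT.
have [->|ec] := eqVneq e c.
  apply: packable_sub c_pack; apply/fintype.subsetP => j.
  by rewrite !inE ffunE; case: (eqVneq j i).
apply: packable_sub (st_pack e); apply/fintype.subsetP => j.
rewrite !inE ffunE; case: (eqVneq j i) => // _ /eqP[ce].
by rewrite ce eqxx in ec.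
Qed.

Lemma parent_lt st i j : is_placement K w r st -> st i = Some (Some j) ->
  (j < i)%N.
Proof.
move=> [st_par _] /st_par[_ rij]; rewrite ltnNge leq_eqVlt.
have : r i < r j by apply: le_lt_trans rij _; rewrite ltrBlDr ltrDl.
by apply: contraTN => /orP[/eqP/val_inj->|/r_decr /ltW]; rewrite ?ltxx// leNgt.
Qed.

Definition initial S m : {set 'I_n} := [set j in S | (j < m)%N]%SET.

(** Parents are larger than their children, so dropping all rings from m on
orphans none of the remaining ones. *)
Lemma feasible_initial S m : feasible K w r S -> feasible K w r (initial S m).
Proof.
move=> [st [<- st_ok]]; have [st_par st_pack] := st_ok.
pose st' : assignment n := [ffun j : 'I_n => if (j < m)%N then st j else None].
exists st'; split.
  by apply/finset.setP => j; rewrite !inE ffunE; case: ifP; rewrite ?andbT ?andbF.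
split=> [i j|c].
  rewrite !inE !ffunE; case: ifP => // im sti; have [] := st_par _ _ sti.
  by rewrite inE (ltn_trans (parent_lt st_ok sti) im).
apply: packable_sub (st_pack c); apply/fintype.subsetP => j.
by rewrite !inE ffunE; case: ifP.
Qed.

(** * The exchange argument *)

Section Exchange.
Hypothesis r_super : forall i, \sum_(j < n | (i < j)%N) r j <= r i.

(** Ring k moves to the parent c' that st gives it, and the smaller rings that F
has in c' take its place in c.  In c' only rings up to k remain, and they are
also siblings in st, so that packing of c' is reused; in c the packing is that
of F with ball k exchanged. *)
Lemma exchange_first_difference st F k :
  is_placement K w r st -> is_placement K w r F ->
  placed st \subset placed F -> k \in placed st ->
  (forall j, (j < k)%N -> F j = st j) ->
  exists F', [/\ is_placement K w r F', placed F' = placed F &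
    forall j, (j <= k)%N -> F' j = st j].
Proof.
move=> [st_par st_pack] [F_par F_pack] stF kst agree.
have := fintype.subsetP stF _ kst; move: (kst).
rewrite !inE; case stk: (st k) => [c'|//] _; case Fk: (F k) => [c|//] _.
have [cc'|cc'] := eqVneq c c'.
  exists F; split=> // j; rewrite leq_eqVlt => /orP[/eqP/val_inj->|/agree//].
  by rewrite Fk stk cc'.
pose moved (j : 'I_n) := (k < j)%N && (F j == Some c').
pose F' : assignment n := [ffun j => if j == k then Some c'
  else if moved j then Some c else F j].
have F'placed : placed F' = placed F.
  apply/finset.setP => j; rewrite !inE ffunE /moved.
  case: (eqVneq j k) => [->|_]; first by rewrite Fk.
  by case: ifP => [/andP[_ /eqP->]|].
exists F'; split=> //; last first.
  move=> j; rewrite leq_eqVlt ffunE => /orP[/eqP/val_inj->|jk].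
    by rewrite eqxx stk.
  by rewrite -val_eqE ltn_eqF//= /moved ltnNge (ltnW jk)/= agree.
split=> [j p|e].
  rewrite F'placed ffunE; case: (eqVneq j k) => [-> [c'p]|_].
    have [|pst rkp] := st_par k p; first by rewrite stk c'p.
    by split=> //; exact: (fintype.subsetP stF).
  case: ifP => [/andP[kj _] [cp]|_]; last exact: F_par.
  have [|pF rkp] := F_par k p; first by rewrite Fk cp.
  by split=> //; apply: le_trans rkp; exact/ltW/r_decr.
have [->|ec'] := eqVneq e c'.
  apply: packable_sub (st_pack c'); apply/fintype.subsetP => j.
  rewrite !inE ffunE; case: (eqVneq j k) => [->|jk]; first by rewrite stk.
  case: ifP => [_ /eqP[cE]|]; first by rewrite cE eqxx in cc'.
  rewrite /moved => jmov Fj; rewrite Fj andbT in jmov.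
  rewrite -agree// ltn_neqAle val_eqE jk/= leqNgt jmov//.
have [->|ec] := eqVneq e c.
  apply: packable_sub (packable_exchange d_ge1 r_gt0 (r_super k)
    (T := [set j | moved j]%SET) (k := k) _ _ (F_pack c)).
  - apply/fintype.subsetP => j; rewrite !inE ffunE; case: (eqVneq j k) => [jk|jk].
      by move=> /eqP[cE]; rewrite cE eqxx in cc'.
    by case: ifP => [_ _|_ ->]; rewrite ?orbT.
  - by rewrite inE Fk.
  - by move=> j; rewrite inE => /andP[].
apply: packable_sub (F_pack e); apply/fintype.subsetP => j.
rewrite !inE ffunE; case: (eqVneq j k) => [_ /eqP[cE]|_].
  by rewrite cE eqxx in ec'.
by case: ifP => // _ /eqP[cE]; rewrite cE eqxx in ec.
Qed.

(** Correcting the first difference repeatedly, from the largest ring down, makes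
the two placements agree on all rings before i. *)
Lemma agree_below st i :
  is_placement K w r st -> (forall j, j \in placed st -> (j < i)%N) ->
  feasible K w r (i |: placed st)%SET ->
  exists F, [/\ is_placement K w r F, placed F = (i |: placed st)%SET &
    forall j, (j < i)%N -> F j = st j].
Proof.
move=> st_ok st_lt [F0 [F0E F0_ok]].
suff H m : (m <= i)%N -> exists F, [/\ is_placement K w r F,
    placed F = (i |: placed st)%SET & forall j, (j < m)%N -> F j = st j].
  exact: H.
elim: m => [|m IH] mi; first by exists F0.
have [F [F_ok FE agree]] := IH (ltnW mi).
pose k : 'I_n := Ordinal (ltn_trans mi (ltn_ord i)).
have [kst|kst] := boolP (k \in placed st).
  have stF : placed st \subset placed F by rewrite FE finset.subsetUr.
  have [F' [F'_ok F'E agree']] :=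
    exchange_first_difference st_ok F_ok stF kst agree.
  by exists F'; rewrite F'E.
exists F; split=> // j; rewrite ltnS leq_eqVlt => /orP[/eqP jm|/agree//].
have -> : j = k by exact: val_inj.
have : k \notin placed F.
  by rewrite FE !inE negb_or -in_placed kst -val_eqE/= ltn_eqF.
by move: kst; rewrite !in_placed !negbK => /eqP-> /eqP->.
Qed.

(** The choices made so far cannot hurt: a placement of the enlarged set that
agrees with st before i shows, by its parent of i, a container that admits i
in st. *)
Lemma admits_feasible st i :
  is_placement K w r st -> (forall j, j \in placed st -> (j < i)%N) ->
  (exists c, admits K w r st i c) <-> feasible K w r (i |: placed st)%SET.
Proof.
move=> st_ok st_lt.
have ist : i \notin placed st by apply/negP => /st_lt; rewrite ltnn.
split=> [[c ic]|/(agree_below st_ok st_lt)[F [F_ok FE agree]]].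
  exists (assign st i c); split; first exact: placed_assign.
  exact: is_placement_assign.
have : i \in placed F by rewrite FE finset.setU11.
rewrite in_placed; case Fi: (F i) => [c|//] _; exists c; split.
  case: c Fi => // p Fi; have pi := parent_lt F_ok Fi.
  have [/(_ _ _ Fi)[+ _] _] := F_ok.
  by rewrite /= FE !inE -val_eqE/= ltn_eqF.
apply: packable_sub (F_ok.2 c); apply/fintype.subsetP => j.
rewrite !inE => /orP[/eqP->|/eqP stj]; first by rewrite Fi.
by rewrite agree ?stj//; apply: st_lt; rewrite in_placed stj.
Qed.

End Exchange.
End Placements.

(** * The lex-max set and its value *)

(** Invariant rule for two scans of the rings run in parallel, with the number of
rings scanned so far as a parameter of the invariant. *)
Lemma foldl_enum_ord_ind2 n (T U : Type) (P : nat -> T -> U -> Prop)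
    (f : T -> 'I_n -> T) (g : U -> 'I_n -> U) x y :
  P 0%N x y ->
  (forall (i : 'I_n) x y, P i x y -> P i.+1 (f x i) (g y i)) ->
  P n (foldl f x (enum 'I_n)) (foldl g y (enum 'I_n)).
Proof.
move=> P0 PS; suff H s m a b : map val s = iota m (size s) -> P m a b ->
    P (m + size s)%N (foldl f a s) (foldl g b s).
  rewrite -[n in P n]size_enum_ord; apply: (H _ 0%N) => //.
  by rewrite val_enum_ord size_enum_ord.
elim: s m a b => [|i s IH] m a b /=; first by rewrite addn0.
move=> [im sm] Pm; rewrite addnS -addSn; apply: IH => //.
by rewrite -im; apply: PS; rewrite im.
Qed.

Section LexMax.
Variables (R : realType) (d n : nat) (K : set 'rV[R]_d) (w : R) (r : 'I_n -> R).
Hypotheses (w_gt0 : 0 < w) (r_gt0 : forall i, 0 < r i).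
Hypothesis r_decr : forall i j : 'I_n, (i < j)%N -> r j < r i.
Implicit Types (i j k : 'I_n) (S : {set 'I_n}).

(** Rings added after k do not change the part of the set before k, so the reason
for rejecting k is still visible in the final set. *)
Lemma lexmax_spec : feasible K w r (lexmax K w r) /\
  forall k, k \notin lexmax K w r ->
    ~ feasible K w r (k |: initial (lexmax K w r) k)%SET.
Proof.
pose P m (L : {set 'I_n}) (_ : unit) :=
  [/\ feasible K w r L, forall j, j \in L -> (j < m)%N &
    forall k, (k < m)%N -> k \notin L ->
      ~ feasible K w r (k |: initial L k)%SET].
suff [L_ok _ L_max] : P n (lexmax K w r) (foldl (fun u _ => u) tt (enum 'I_n)).
  by split=> // k; exact: L_max.
apply: foldl_enum_ord_ind2 => [|i L u [L_ok L_lt L_max]].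
  split=> // [|j]; last by rewrite finset.in_set0.
  by exists (unplaced n); split; [exact: placed_unplaced|exact: is_placement_unplaced].
have L_init : initial L i = L.
  by apply/finset.setP => j; rewrite inE andb_idr//; exact: L_lt.
case: asboolP => [iL_ok|iL_nok].
  split=> // [j|k].
    by rewrite !inE => /orP[/eqP->//|/L_lt/ltnW]; rewrite ltnS.
  rewrite ltnS leq_eqVlt !inE negb_or -val_eqE/= => /orP[->//|ki] /andP[_ kL].
  have -> : initial (i |: L) k = initial L k; last exact: L_max.
  apply/finset.setP => j; rewrite !inE; case: (eqVneq j i) => //= ->.
  by rewrite ltnNge (ltnW ki)/= andbF.
split=> // [j /L_lt/ltnW|k]; first by rewrite ltnS.
rewrite ltnS leq_eqVlt => /orP[/eqP/val_inj->|]; last exact: L_max.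
by rewrite L_init.
Qed.

Section Value.
Hypothesis r_super : forall i, \sum_(j < n | (i < j)%N) r j <= r i.
Variable v : R -> R.
Hypotheses (v_gt0 : forall x, 0 < x -> 0 < v x).
Hypotheses (v_incr : forall x y, 0 < x -> x < y -> v x < v y).
Hypotheses (v_super : superadditive v).

(** The sum over an empty family is a case of its own in the induction, since
nothing is assumed of v at 0. *)
Lemma superadditive_sum_le (Q : pred 'I_n) b :
  0 < b -> \sum_(j | Q j) r j <= b -> \sum_(j | Q j) v (r j) <= v b.
Proof.
move=> b0.
have [[-> _] _|[s0 vs] sb] : (\sum_(j | Q j) v (r j) = 0 /\ \sum_(j | Q j) r j = 0) \/
    0 < \sum_(j | Q j) r j /\ \sum_(j | Q j) v (r j) <= v (\sum_(j | Q j) r j).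
- apply: (big_ind2 (fun x y => (x = 0 /\ y = 0) \/ 0 < y /\ x <= v y)).
  + by left.
  + move=> x1 y1 x2 y2 [[-> ->]|[y10 x1y1]]; first by rewrite !add0r.
    case=> [[-> ->]|[y20 x2y2]]; first by rewrite !addr0; right.
    right; split; first exact: addr_gt0.
    by apply: le_trans (v_super y10 y20); exact: lerD.
  + by move=> i _; right.
- exact/ltW/v_gt0.
- apply: le_trans vs _; move: sb; rewrite le_eqVlt => /orP[/eqP->//|sb].
  exact/ltW/v_incr.
Qed.

(** At the first ring k that separates a feasible S from the lex-max set L, ring k
lies in L: otherwise the part of S up to k would show that the scan should have
taken k.  The rings of S after k have total radius at most r_k, so they are
worth at most v(r_k), which L collects from k alone. *)
Lemma lexmax_optimal : optimal K w r v (lexmax K w r).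
Proof.
have [L_ok L_max] := lexmax_spec; split=> // S S_ok.
set L := lexmax K w r in L_ok L_max *.
have [->//|SL] := eqVneq S L.
have [k0 k0P] : exists k, (k \in S) != (k \in L).
  apply/existsP; apply: contraNT SL; rewrite negb_exists => /forallP SL.
  by apply/eqP/finset.setP => k; apply/eqP; rewrite -[_ == _]negbK.
pose differ j := (j \in S) != (j \in L).
have [k kP kmin] := @arg_minnP _ k0 differ (@nat_of_ord n) k0P; rewrite /differ in kP.
have agree j : (j < k)%N -> (j \in S) = (j \in L).
  by move=> jk; apply/eqP; apply: contraLR jk => /kmin; rewrite -leqNgt.
have agree_init : initial S k = initial L k.
  by apply/finset.setP => j; rewrite !inE; case: ltnP; rewrite ?andbF// !andbT => /agree.
have kL : k \in L.
  apply/negPn/negP => kL; apply: (L_max _ kL); rewrite -agree_init.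
  have kS : k \in S by move: kP; rewrite (negbTE kL); case: (k \in S).
  suff <- : initial S k.+1 = (k |: initial S k)%SET by exact: feasible_initial.
  apply/finset.setP => j; rewrite !inE ltnS leq_eqVlt val_eqE.
  by case: (eqVneq j k) => [->|]//=; rewrite kS.
have kS : k \notin S by move: kP; rewrite kL; case: (k \in S).
rewrite (bigID (fun j : 'I_n => j < k)%N)/= [leRHS](bigID (fun j : 'I_n => j < k)%N)/=.
apply: lerD.
  rewrite le_eqVlt; apply/orP; left; apply/eqP/eq_bigl => j.
  by case: ltnP => [/agree->|]; rewrite ?andbF.
apply: (@le_trans _ _ (v (r k))).
  apply: superadditive_sum_le => //; apply: le_trans (r_super k).
  rewrite big_mkcond [leRHS]big_mkcond/=; apply: ler_sum => j _.
  have rj0 := ltW (r_gt0 j).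
  case: ifP => [/andP[jS jk]|_]; last by case: ifP.
  rewrite -leqNgt in jk; rewrite ifT// ltn_neqAle jk andbT.
  by apply: contraNneq kS => /val_inj->.
rewrite (bigD1 k)/=; last by rewrite kL ltnn.
by rewrite lerDl; apply: sumr_ge0 => j _; exact/ltW/v_gt0.
Qed.

End Value.
End LexMax.

(** * Deterministic and random greedy *)

Section Greedy.
Variables (R : realType) (d n : nat) (K : set 'rV[R]_d) (w : R) (r : 'I_n -> R).
Hypotheses (d_ge1 : (1 <= d)%N) (w_gt0 : 0 < w) (r_gt0 : forall i, 0 < r i).
Hypothesis r_decr : forall i j : 'I_n, (i < j)%N -> r j < r i.
Hypothesis r_super : forall i : 'I_n, \sum_(j < n | (i < j)%N) r j <= r i.
Implicit Types (st : assignment n) (c : container n) (i j k : 'I_n).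
Implicit Types (L : {set 'I_n}).

Definition lexmax_step L i : {set 'I_n} :=
  if `[< feasible K w r (i |: L)%SET >] then (i |: L)%SET else L.

(** Common invariant of the scan for the lex-max set and of a greedy run. *)
Definition greedy_state (m : nat) L st : Prop :=
  [/\ is_placement K w r st, placed st = L & forall j, j \in L -> (j < m)%N].

Lemma greedy_state0 : greedy_state 0 finset.set0 (unplaced n).
Proof.
split; [exact: is_placement_unplaced|exact: placed_unplaced|].
by move=> j; rewrite finset.in_set0.
Qed.

Lemma lexmax_stepE st L i : greedy_state i L st ->
  lexmax_step L i = if `[< exists c, admits K w r st i c >]
                    then (i |: L)%SET else L.
Proof.
move=> [st_ok <- L_lt]; rewrite /lexmax_step; congr (if _ then _ else _).
apply/asbool_equiv_eq; symmetry.
exact: (admits_feasible d_ge1 w_gt0 r_gt0 r_decr r_super).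
Qed.

Lemma greedy_state_assign st L i c : greedy_state i L st ->
  admits K w r st i c -> greedy_state i.+1 (lexmax_step L i) (assign st i c).
Proof.
move=> stL ic; rewrite (lexmax_stepE stL) ifT; last by apply/asboolP; exists c.
have [st_ok stLE L_lt] := stL.
have ist : i \notin placed st by rewrite stLE; apply/negP => /L_lt; rewrite ltnn.
split; first exact: is_placement_assign.
  by rewrite placed_assign stLE.
by move=> j; rewrite !inE => /orP[/eqP->//|/L_lt/ltnW]; rewrite ltnS.
Qed.

Lemma greedy_state_skip st L i : greedy_state i L st ->
  ~ (exists c, admits K w r st i c) -> greedy_state i.+1 (lexmax_step L i) st.
Proof.
move=> stL nadm; rewrite (lexmax_stepE stL) ifF; last exact/asboolPn.
by have [st_ok stLE L_lt] := stL; split=> // j /L_lt/ltnW; rewrite ltnS.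
Qed.

Lemma greedy_lexmax (rule : placement_rule n) : valid_rule K w r rule ->
  placed (greedy K w r rule) = lexmax K w r.
Proof.
move=> rule_ok.
suff [_ -> //] : greedy_state n (lexmax K w r) (greedy K w r rule).
apply: (foldl_enum_ord_ind2 (P := greedy_state)); first exact: greedy_state0.
move=> i L st stL; rewrite /greedy_step.
case: (asboolP (exists c, admits K w r st i c)) => adm.
  exact: (greedy_state_assign stL (rule_ok _ _ adm)).
exact: (greedy_state_skip stL adm).
Qed.

Section Random.
Variable mu : random_rule R n.
Hypothesis mu_ok : valid_random_rule K w r mu.

Lemma transition_mass i st : \sum_st' transition K w r mu i st st' = 1.
Proof.
have sum_eq (x : assignment n) : \sum_(st' : assignment n) (st' == x)%:R = 1 :> R.
  by rewrite (bigD1 x)//= eqxx big1 ?addr0// => y /negbTE->.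
rewrite /transition; case: asboolP => adm; last exact: sum_eq.
have [_ _ mu1] := mu_ok adm; rewrite exchange_big/= -[RHS]mu1.
by apply: eq_bigr => c _; rewrite -mulr_sumr sum_eq mulr1.
Qed.

Lemma transition_support i L st st' : greedy_state i L st ->
  transition K w r mu i st st' != 0 -> greedy_state i.+1 (lexmax_step L i) st'.
Proof.
move=> stL; rewrite /transition; case: asboolP => adm; last first.
  case: (eqVneq st' st) => [-> _|_]; last by rewrite eqxx.
  exact: (greedy_state_skip stL adm).
have [_ mu_supp _] := mu_ok adm.
rewrite psumr_neq0; last first.
  by have [mu0 _ _] := mu_ok adm => c _; rewrite mulr_ge0.
move=> /hasP[c _ /= /lt0r_neq0]; rewrite mulf_eq0 negb_or => /andP[muc].
case: (eqVneq st' (assign st i c)) => [-> _|_]; last by rewrite eqxx.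
apply: greedy_state_assign => //; apply: contrapT => /mu_supp muc0.
by rewrite muc0 eqxx in muc.
Qed.

(** The law keeps total mass 1, and each state in its support is reached by a
sequence of admitting choices, so the invariant of the deterministic run holds
for all of them. *)
Lemma random_greedy_spec :
  \sum_st random_greedy K w r mu st = 1 /\
  forall st, random_greedy K w r mu st != 0 -> placed st = lexmax K w r.
Proof.
pose P m L (D : assignment n -> R) :=
  \sum_st D st = 1 /\ forall st, D st != 0 -> greedy_state m L st.
suff [? D_supp] : P n (lexmax K w r) (random_greedy K w r mu).
  by split=> // st /D_supp[].
apply: foldl_enum_ord_ind2 => [|i L D [D1 D_supp]].
  split; first by rewrite (bigD1 (unplaced n))//= eqxx big1 ?addr0// => y /negbTE->.
  move=> st; case: (eqVneq st (unplaced n)) => [-> _|_]; last by rewrite eqxx.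
  exact: greedy_state0.
split.
  rewrite exchange_big/= -[RHS]D1; apply: eq_bigr => st _.
  by rewrite -mulr_sumr transition_mass mulr1.
move=> st'; apply: contraNP => st'_bad; apply/eqP/big1 => st _.
apply/eqP; apply: contra_notT st'_bad; rewrite mulf_eq0 negb_or => /andP[/D_supp stL].
exact: transition_support.
Qed.

Lemma random_greedy_prob_lexmax (E : {set 'I_n} -> Prop) :
  E (lexmax K w r) -> random_greedy_prob K w r mu E = 1.
Proof.
move=> EL; have [D1 D_supp] := random_greedy_spec.
rewrite /random_greedy_prob -[RHS]D1 [RHS](bigID (fun st => `[< E (placed st) >]))/=.
rewrite [X in _ + X]big1 ?addr0// => st /asboolPn nE.
by apply: contra_notP nE => /eqP/D_supp ->.
Qed.

End Random.
End Greedy.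

Theorem theorem9 (R : realType) (d n : nat) (d_ge1 : (1 <= d)%N)
    (K : set 'rV[R]_d) (K_compact : compact K) (w : R) (w_gt0 : 0 < w)
    (r : 'I_n -> R) (r_gt0 : forall i, 0 < r i)
    (r_decr : forall i j : 'I_n, (i < j)%N -> r j < r i)
    (r_super : forall i : 'I_n, \sum_(j < n | (i < j)%N) r j <= r i) :
  [/\ (forall rule : placement_rule n, valid_rule K w r rule ->
        placed (greedy K w r rule) = lexmax K w r),
      (forall mu : random_rule R n, valid_random_rule K w r mu ->
        random_greedy_prob K w r mu (fun S => S = lexmax K w r) = 1)
    & forall v : R -> R,
        (forall x, 0 < x -> 0 < v x) ->
        (forall x y, 0 < x -> x < y -> v x < v y) ->
        superadditive v ->
        [/\ (forall rule : placement_rule n, best_fit K w r rule ->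
              optimal K w r v (placed (greedy K w r rule))),
            (forall rule : placement_rule n, worst_fit K w r rule ->
              optimal K w r v (placed (greedy K w r rule)))
          & (forall mu : random_rule R n, valid_random_rule K w r mu ->
              random_greedy_prob K w r mu (optimal K w r v) = 1)]].
Proof.
split=> [rule rule_ok|mu mu_ok|v v_gt0 v_incr v_super].
- exact: greedy_lexmax.
- exact: random_greedy_prob_lexmax.
have L_opt : optimal K w r v (lexmax K w r) by exact: lexmax_optimal.
split=> [rule [rule_ok _]|rule [rule_ok _]|mu mu_ok].
- by rewrite greedy_lexmax.
- by rewrite greedy_lexmax.
- exact: random_greedy_prob_lexmax.
Qed.
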